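(* Let $N$ be a chain-group on $V$ to $K$. Then $\lambda_N$ is submodular: for all $X,Y\subseteq V$, \[\lambda_N(X)+\lambda_N(Y)\ge\lambda_N(X\cup Y)+\lambda_N(X\cap Y).\]
   Context: $\mathbb{F}$ is a field and $K=\mathbb{F}^2$ (with a bilinear form $\langle\,,\,\rangle_K$ equal to $ad+bc$ or $ad-bc$ on $\binom ab,\binom cd$). A chain on a finite set $V$ to $K$ is a map $V\to K$; a chain-group is a subspace $N$ of $K^V$. For $T\subseteq V$, $N\times T=\{f|_T: f\in N,\ f(x)=0\ \forall x\in V\setminus T\}$. The connectivity function is $\lambda_N(U)=\frac12(\dim N-\dim(N\times(V\setminus U))-\dim(N\times U))$. *)

(* Defs.v *)
From HB Require Import structures.
From mathcomp Require Import all_boot all_order all_algebra.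

Set Implicit Arguments.
Unset Strict Implicit.
Unset Printing Implicit Defensive.

Import GRing.Theory.
Local Open Scope ring_scope.

(* K = F^2.  The bilinear form <,>_K does not enter any of the notions below,
   so it is not part of the data. *)
Notation K F := 'cV[F]_2.

Notation chain F V := {ffun V -> K F}.

Notation chain_group F V := {vspace chain F V}.

Section ChainGroups.
Variables (F : fieldType) (V : finType).
Implicit Types (N : chain_group F V) (T U : {set V}).

Definition restrict T (f : chain F V) : chain F {x : V | x \in T} :=
  [ffun x => f (val x)].

Lemma restrict_is_linear T : linear (restrict T).
Proof. by move=> a f g; apply/ffunP => x; rewrite !ffunE. Qed.

HB.instance Definition _ T :=
  GRing.isLinear.Build F (chain F V) (chain F {x : V | x \in T}) _ (restrict T)
    (restrict_is_linear T).

(* N x T, a chain-group on T: the image under restriction to T of the chains of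
   N whose restriction to V \ T is zero.  See chain_minorP. *)
Definition chain_minor N T : chain_group F {x : V | x \in T} :=
  (linfun (restrict T) @: (N :&: lker (linfun (restrict (~: T)))))%VS.

Lemma chain_minorP N T (g : chain F {x : V | x \in T}) :
  reflect (exists2 f : chain F V,
             f \in N /\ (forall x, x \notin T -> f x = 0) & g = restrict T f)
          (g \in chain_minor N T).
Proof.
apply: (iffP memv_imgP) => [[f]|[f [fN f0] ->]].
  rewrite memv_cap memv_ker lfunE => /andP[fN /eqP f0] ->.
  exists f; last by rewrite lfunE.
  split=> // x xT; have xT' : x \in ~: T by rewrite inE.
  by have /ffunP/(_ (exist _ x xT')) := f0; rewrite !ffunE.
exists f; last by rewrite lfunE.
rewrite memv_cap fN memv_ker lfunE; apply/eqP/ffunP => -[x /= xT].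
by rewrite !ffunE /= f0 // -in_setC.
Qed.

Definition connectivity N U : rat :=
  ((\dim N)%:R - (\dim (chain_minor N (~: U)))%:R
     - (\dim (chain_minor N U))%:R) / 2%:R.

End ChainGroups.

(* Main.v *)
Require Import Defs.
From HB Require Import structures.
From mathcomp Require Import all_boot all_order all_algebra.
From mathcomp Require Import lra.

Set Implicit Arguments.
Unset Strict Implicit.
Unset Printing Implicit Defensive.

Import GRing.Theory.
Local Open Scope ring_scope.

(** Restriction to [T] is injective on the subspace [N_T] of the chains of [N]
    supported in [T], so [dim (N x T) = dim N_T]. As [N_X :&: N_Y] is the
    subspace of [X :&: Y] and [N_X + N_Y] lies in that of [X :|: Y], the
    function [T |-> dim (N x T)] is supermodular, and so is its composite with
    complementation. *)

Section Supermodularity.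
Variables (F : fieldType) (V : finType).
Implicit Types (N : chain_group F V) (S T X Y : {set V}).

(** The subspace whose image is [chain_minor N T]. It stays inside [chain F V], so that different
    [T] can be summed and intersected. *)
Definition supported N T : chain_group F V :=
  (N :&: lker (linfun (restrict (~: T))))%VS.

Lemma supportedP N T (f : chain F V) :
  reflect (f \in N /\ forall x, x \notin T -> f x = 0) (f \in supported N T).
Proof.
rewrite memv_cap memv_ker lfunE /=; apply: (iffP andP) => -[fN f0]; split=> //.
  move=> x xT; have xT' : x \in ~: T by rewrite inE.
  by have /eqP/ffunP/(_ (exist _ x xT')) := f0; rewrite !ffunE.
by apply/eqP/ffunP => -[x /= xT]; rewrite !ffunE /= f0 // -in_setC.
Qed.

Lemma dim_chain_minor N T : \dim (chain_minor N T) = \dim (supported N T).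
Proof.
(* Injectivity: a chain vanishing both off [T] and on [T] is zero. *)
apply: limg_dim_eq; apply/eqP; rewrite -subv0; apply/subvP => f.
rewrite memv_cap memv0 memv_ker lfunE => /andP[/supportedP[_ f0] /eqP fT0].
apply/eqP/ffunP => x; rewrite [RHS]ffunE.
case: (boolP (x \in T)) => [xT|/f0//].
by have /ffunP/(_ (exist _ x xT)) := fT0; rewrite !ffunE.
Qed.

Lemma supportedS N S T : S \subset T -> (supported N S <= supported N T)%VS.
Proof.
move=> /subsetP sST; apply/subvP => f /supportedP[fN f0]; apply/supportedP.
by split=> // x xT; apply: f0; apply: contra xT; apply: sST.
Qed.

Lemma supportedI N X Y :
  supported N (X :&: Y) = (supported N X :&: supported N Y)%VS.
Proof.
apply/eqP; rewrite eqEsubv subv_cap !supportedS ?subsetIl ?subsetIr //=.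
apply/subvP => f; rewrite memv_cap => /andP[/supportedP[fN fX] /supportedP[_ fY]].
by apply/supportedP; split=> // x; rewrite inE negb_and => /orP[/fX|/fY].
Qed.

Lemma dim_chain_minor_supermodular N X Y :
  (\dim (chain_minor N X) + \dim (chain_minor N Y)
    <= \dim (chain_minor N (X :|: Y)) + \dim (chain_minor N (X :&: Y)))%N.
Proof.
(* By the dimension formula for a sum, the intersection terms cancel; only the inclusion of the sum
   remains. *)
rewrite !dim_chain_minor supportedI -dimv_sum_cap leq_add2r; apply: dimvS.
by rewrite subv_add !supportedS ?subsetUl ?subsetUr.
Qed.

End Supermodularity.

Theorem theorem3p13 (F : fieldType) (V : finType) (N : chain_group F V)
    (X Y : {set V}) :
  connectivity N (X :|: Y) + connectivity N (X :&: Y)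
    <= connectivity N X + connectivity N Y.
Proof.
(* The [\dim N] terms cancel. Each of the two subtracted dimensions is supermodular; for the
   complements, De Morgan swaps union and intersection. *)
rewrite /connectivity setCU setCI.
have := dim_chain_minor_supermodular N X Y.
have := dim_chain_minor_supermodular N (~: X) (~: Y).
rewrite -!(Num.Theory.ler_nat rat) !natrD; lra.
Qed.
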